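(* Let $y\in\mathbb{R}^d$, $\lambda>0$, and $X=[x_1,\cdots,x_n]\in\mathbb{R}^{d\times n}$. Let $w^*=[w_1^*,\cdots,w_n^*]^T\in\mathbb{R}^n$ be the optimal solution to $$\min_{w\in\mathbb{R}^n}\ \tfrac{1}{2}\|y-Xw\|_2^2+\lambda\|X\,\mathrm{Diag}(w)\|_*.$$ If $x_i\rightarrow x_j$ (with $y$, $\lambda$ and the other columns of $X$ fixed), then $w_i^*\rightarrow w_j^*$, i.e., $w_i^*-w_j^*\to 0$.
   Context: $\mathrm{Diag}(w)$ is the diagonal matrix with diagonal $w$, and $\|\cdot\|_*$ is the nuclear norm (sum of singular values). *)

(* Defs.v *)
From HB Require Import structures.
From mathcomp Require Import all_boot all_order all_algebra.
From mathcomp Require Import all_classical all_reals all_analysis.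
Set Implicit Arguments. Unset Strict Implicit. Unset Printing Implicit Defensive.
Import Order.TTheory GRing.Theory Num.Theory.
Local Open Scope ring_scope.
Local Open Scope classical_set_scope.

Section TraceLasso.
Variable R : realType.

(* s is a list of singular values of A (with multiplicity, n of them):
   nonnegative reals whose squares are the eigenvalues of A^T A
   (i.e. the roots, with multiplicity, of its characteristic polynomial). *)
Definition singular_values_spec (d n : nat) (A : 'M[R]_(d, n)) (s : seq R) :=
  all (fun x => 0 <= x) s /\
  char_poly (A^T *m A) = \prod_(x <- s) ('X - (x ^+ 2)%:P).

Definition nucnorm (d n : nat) (A : 'M[R]_(d, n)) : R :=
  \sum_(x <- xget [::] [set s | singular_values_spec A s]) x.

Definition sqnorm (d : nat) (v : 'cV[R]_d) : R := \sum_(r < d) (v r 0) ^+ 2.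

Definition trace_lasso_obj (d n : nat) (y : 'cV[R]_d) (lam : R)
    (X : 'M[R]_(d, n)) (w : 'cV[R]_n) : R :=
  2^-1 * sqnorm (y - X *m w) + lam * nucnorm (X *m diag_mx w^T).

Definition is_unique_minimizer (d n : nat) (y : 'cV[R]_d) (lam : R)
    (X : 'M[R]_(d, n)) (w : 'cV[R]_n) : Prop :=
  (forall v, trace_lasso_obj y lam X w <= trace_lasso_obj y lam X v) /\
  (forall v, (forall u, trace_lasso_obj y lam X v <= trace_lasso_obj y lam X u) -> v = w).

End TraceLasso.

(* Main.v *)
Require Import Defs.
From HB Require Import structures.
From mathcomp Require Import all_boot all_order all_algebra.
From mathcomp Require Import complex.
From mathcomp Require Import all_classical all_reals all_analysis.
From mathcomp Require Import ring lra.
Set Implicit Arguments. Unset Strict Implicit. Unset Printing Implicit Defensive.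
Import Order.TTheory GRing.Theory Num.Theory numFieldNormedType.Exports.
Local Open Scope ring_scope.
Local Open Scope classical_set_scope.

(* Writing the nuclear norm as a maximum of [\tr (Z^T A)] over contractions [Z]
   gives two estimates: a rank one change [c u^T] moves it by at most [|c| |u|],
   and if [A u = 0] then [nuc (A + c u^T)^2 >= nuc A ^2 + |c|^2 |u|^2].
   If [x_i] is replaced by [x = x_j], then [X Diag(w)] differs from the matrix
   obtained by averaging [w_i] and [w_j] by [delta x (e_i - e_j)^T], where
   [delta = (w_i - w_j) / 2], and the averaged matrix kills [e_i - e_j].  Hence
   averaging lowers the square of the nuclear norm by at least
   [2 delta^2 |x|^2], up to errors of order [|x_i - x_j|].  Optimality of [w]
   then bounds [(w_i - w_j)^2] by a multiple of [|x_i - x_j|], the coefficients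
   being bounded because the objective is at most its value at [0].
   Uniqueness of the minimizer enters only through [x_j <> 0]. *)

(** * Diagonalization of real symmetric matrices *)

Lemma symmetric_eigenvalue (R : rcfType) n (S : 'M[R]_n.+1) :
  S^T = S -> exists a, eigenvalue S a.
Proof.
(* Over [complex R] the matrix becomes hermitian, so its spectral diagonal is real. Row 0 of the
   invertible [P] is an eigenvector for [D 0 0], and this real eigenvalue descends to [R]. *)
move=> symS; pose SC : 'M[complex R]_n.+1 := map_mx (real_complex R) S.
have hermS : SC \is hermsymmx.
  apply: realsym_hermsym.
    apply/is_hermitianmxP; rewrite expr0 scale1r map_mx_id //.
    by rewrite /SC map_trmx symS.
  by apply/mxOverP => i j; rewrite mxE complex_real.
have /mxOverP/(_ 0 0) := hermitian_spectral_diag_real hermS.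
have /hermitian_normalmx/orthomx_spectralP eqS := hermS.
set P := spectralmx SC in eqS *; set D := spectral_diag SC in eqS *.
have unitP : P \in unitmx by exact: spectral_unit.
have PS : P *m SC = diag_mx D *m P by rewrite {1}eqS !mulmxA mulmxV // mul1mx.
have : eigenvalue SC (D 0 0).
  apply/eigenvalueP; exists (row 0 P).
    by rewrite -row_mul PS mul_diag_mx; apply/rowP => k; rewrite !mxE.
  apply/eqP => /(congr1 (mulmx^~ (invmx P))); rewrite -row_mul mulmxV // mul0mx.
  by move=> /rowP/(_ 0)/eqP; rewrite !mxE eqxx oner_eq0.
move=> eigD /complex_realP [a Da]; exists a.
by move: eigD; rewrite Da eigenvalue_map.
Qed.

Lemma mul_trmx_col (R : comNzRingType) n (u : 'cV[R]_n) :
  (u^T *m u) 0 0 = \sum_k u k 0 ^+ 2.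
Proof. by rewrite mxE; apply: eq_bigr => k _; rewrite mxE expr2. Qed.

(** Deflation: conjugating by a reflection that sends [e0] to a unit eigenvector splits off a block
    of size 1, and induction diagonalizes the rest. *)
Lemma symmetric_spectral (R : rcfType) n (S : 'M[R]_n) :
  S^T = S ->
  exists V (e : 'rV_n), V^T *m V = 1%:M /\ V^T *m S *m V = diag_mx e.
Proof.
elim: n S => [|n IHn] S symS.
  by exists 1%:M, 0; split; apply/matrixP; case.
have [a /eigenvalueP [u uS u0]] := symmetric_eigenvalue symS.
pose N := \sum_k u 0 k ^+ 2.
have N0 : 0 < N.
  rewrite lt_def sumr_ge0 ?andbT => [|k _]; last exact: sqr_ge0.
  apply: contra u0 => /eqP/psumr_eq0P u0; apply/eqP/rowP => k; apply/eqP.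
  by rewrite mxE -sqrf_eq0 u0 // => l _; exact: sqr_ge0.
pose v : 'cV_(1 + n) := (Num.sqrt N)^-1 *: u^T.
have vv : (v^T *m v) 0 0 = 1.
  rewrite mul_trmx_col (eq_bigr (fun k => N^-1 * u 0 k ^+ 2)) => [|k _].
    by rewrite -mulr_sumr mulVf ?gt_eqF.
  by rewrite !mxE exprMn exprVn sqr_sqrtr // ltW.
have Sv : S *m v = a *: v.
  by rewrite -scalemxAr scalerA mulrC -scalerA -{1}symS -trmx_mul uS linearZ.
pose e0 : 'cV[R]_(1 + n) := delta_mx 0 0.
pose w := v - e0; pose s := (w^T *m w) 0 0.
have wwE : w^T *m w = s%:M by rewrite [LHS]mx11_scalar.
(* As [v] and [e0] are unit vectors, [s = 2 - 2 * v 0 0], while the product is [v 0 0 - 1]. *)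
have we0 : w^T *m e0 = (- s / 2)%:M.
  rewrite [LHS]mx11_scalar; congr (_%:M).
  have e0v (z : 'cV[R]_(1 + n)) : (z^T *m e0) 0 0 = z 0 0 by rewrite -colE !mxE.
  have e00 : e0 0 0 = 1 by rewrite mxE.
  have -> : s = 2 - 2 * v 0 0.
    have wT : w^T = v^T - e0^T by apply/matrixP => k l; rewrite !mxE.
    rewrite /s wT mulmxBl !mulmxBr.
    have sub00 (A C : 'M[R]_1) : (A - C) 0 0 = A 0 0 - C 0 0 by rewrite !mxE.
    have -> : e0^T *m v = v^T *m e0.
      rewrite -[e0^T *m v]trmxK trmx_mul trmxK.
      by apply/matrixP => k l; rewrite !ord1 mxE.
    by rewrite !sub00 vv !e0v e00; ring.
  rewrite e0v; have -> : w 0 0 = v 0 0 - e0 0 0 by rewrite !mxE.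
  by rewrite e00; field.
(* Householder reflection exchanging [e0] and [v]; it is [1] when [s = 0] *)
pose Q : 'M[R]_(1 + n) := 1%:M - (2 / s) *: (w *m w^T).
have symQ : Q^T = Q.
  by rewrite /Q linearB /= linearZ /= trmx_mul trmxK trmx1.
have QQ : Q *m Q = 1%:M.
  rewrite /Q mulmxBr mulmx1 (mulmxBl 1%:M) mul1mx -scalemxAl -scalemxAr.
  rewrite mulmxA -[w *m w^T *m w]mulmxA wwE mul_mx_scalar -scalemxAl !scalerA.
  rewrite -addrA -opprD -[RHS]subr0; congr (_ - _).
  rewrite -scalerBl -scalerDl; apply/eqP; rewrite scaler_eq0; apply/orP; left.
  apply/eqP; case: (eqVneq s 0) => [->|s0]; last by field.
  by rewrite invr0 !mulr0 subrr addr0.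
have Qe0 : Q *m e0 = v.
  rewrite /Q (mulmxBl 1%:M) mul1mx -scalemxAl -mulmxA we0 mul_mx_scalar scalerA.
  case: (eqVneq s 0) => [s0|s0].
    have w0 : w = 0.
      apply/colP => k; rewrite [RHS]mxE; apply/eqP; rewrite -sqrf_eq0.
      move: s0; rewrite /s mul_trmx_col => /psumr_eq0P -> // l _.
      exact: sqr_ge0.
    by rewrite w0 scaler0 subr0; apply/esym/subr0_eq.
  have -> : 2 / s * (- s / 2) = -1 by field.
  by rewrite scaleN1r opprK /w addrC subrK.
pose B : 'M[R]_(1 + n) := Q *m S *m Q.
have symB : B^T = B by rewrite /B !trmx_mul symQ symS mulmxA.
have Be0 : B *m e0 = a *: e0.
  by rewrite /B -!mulmxA Qe0 Sv -scalemxAr -Qe0 mulmxA QQ mul1mx.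
have EB : B = Q *m S *m Q by [].
clearbody B.
(* The first column of [B] is [a *: e0]; by symmetry so is the transpose of its first row, which
   makes [B] block diagonal. *)
have Bcol k : B k 0 = a * (k == 0)%:R.
  by move/matrixP/(_ k 0) : Be0; rewrite -colE !mxE eqxx andbT.
have [V [e [VV BV]]] : exists V (e : 'rV_n),
    V^T *m V = 1%:M /\ V^T *m drsubmx B *m V = diag_mx e.
  by apply: IHn; rewrite trmx_drsub symB.
have lsh0 : lshift n (0 : 'I_1) = 0 by exact: val_inj.
have dl0 : dlsubmx B = 0.
  by apply/matrixP => k l; rewrite !mxE ord1 lsh0 Bcol mulr0.
have ur0 : ursubmx B = 0 by rewrite -symB -trmx_dlsub dl0 trmx0.
have eB : B = block_mx a%:M 0 0 (drsubmx B).
  rewrite -{1}[B]submxK dl0 ur0; congr block_mx.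
  by rewrite [LHS]mx11_scalar !mxE lsh0 Bcol eqxx mulr1.
pose W : 'M[R]_(1 + n) := block_mx 1%:M 0 0 V.
have WT : W^T = block_mx 1%:M 0 0 V^T by rewrite tr_block_mx !trmx0 trmx1.
have WW : W^T *m W = 1%:M.
  rewrite WT mulmx_block !(mul0mx, mulmx0, addr0, add0r, mul1mx) VV.
  by rewrite -scalar_mx_block.
have WB : W^T *m B *m W = diag_mx (row_mx a%:M e).
  rewrite WT eB !mulmx_block.
  rewrite !(mul0mx, mulmx0, addr0, add0r, mul1mx, mulmx1) BV.
  by rewrite diag_mx_row; congr block_mx; rewrite [RHS]mx11_scalar !mxE.
exists (Q *m W), (row_mx a%:M e : 'rV_(1 + n)).
rewrite trmx_mul symQ !mulmxA -(mulmxA _ Q Q) QQ mulmx1; split=> //.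
by rewrite -WB EB !mulmxA.
Qed.

(** * Euclidean inner product and norm *)

Section Euclidean.
Variables (R : realType).
Implicit Types (m n : nat).

Definition dotc n (u v : 'cV[R]_n) : R := (u^T *m v) 0 0.
Definition norm2 n (v : 'cV[R]_n) : R := Num.sqrt (sqnorm v).

Lemma sqnormE n (v : 'cV[R]_n) : sqnorm v = dotc v v.
Proof. by rewrite /dotc mul_trmx_col. Qed.

Lemma dotcE n (u v : 'cV[R]_n) : dotc u v = \sum_k u k 0 * v k 0.
Proof. by rewrite /dotc mxE; apply: eq_bigr => k _; rewrite mxE. Qed.

Lemma dotcC n (u v : 'cV[R]_n) : dotc u v = dotc v u.
Proof. by rewrite !dotcE; apply: eq_bigr => k _; rewrite mulrC. Qed.

Lemma dotcDr n (u v w : 'cV[R]_n) : dotc u (v + w) = dotc u v + dotc u w.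
Proof. by rewrite /dotc mulmxDr mxE. Qed.

Lemma dotcZr n a (u v : 'cV[R]_n) : dotc u (a *: v) = a * dotc u v.
Proof. by rewrite /dotc -scalemxAr mxE. Qed.

Lemma dotcDl n (u v w : 'cV[R]_n) : dotc (v + w) u = dotc v u + dotc w u.
Proof. by rewrite dotcC dotcDr !(dotcC u). Qed.

Lemma dotcZl n a (u v : 'cV[R]_n) : dotc (a *: u) v = a * dotc u v.
Proof. by rewrite dotcC dotcZr dotcC. Qed.

Lemma dotc_mull m n (A : 'M[R]_(m, n)) u v : dotc (A *m u) v = dotc u (A^T *m v).
Proof. by rewrite /dotc trmx_mul mulmxA. Qed.

Lemma sqnorm_ge0 n (v : 'cV[R]_n) : 0 <= sqnorm v.
Proof. by apply: sumr_ge0 => k _; exact: sqr_ge0. Qed.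

Lemma sqnorm_eq0 n (v : 'cV[R]_n) : sqnorm v = 0 -> v = 0.
Proof.
move=> /psumr_eq0P v0; apply/colP => k; apply/eqP; rewrite mxE -sqrf_eq0.
by rewrite v0 // => l _; exact: sqr_ge0.
Qed.

Lemma sqnormD n (u v : 'cV[R]_n) :
  sqnorm (u + v) = sqnorm u + 2 * dotc u v + sqnorm v.
Proof. by rewrite !sqnormE dotcDr !dotcDl (dotcC v u); ring. Qed.

Lemma sqnormZ n a (v : 'cV[R]_n) : sqnorm (a *: v) = a ^+ 2 * sqnorm v.
Proof. by rewrite !sqnormE dotcZr dotcZl; ring. Qed.

Lemma norm2_ge0 n (v : 'cV[R]_n) : 0 <= norm2 v.
Proof. exact: sqrtr_ge0. Qed.

Lemma sqr_norm2 n (v : 'cV[R]_n) : norm2 v ^+ 2 = sqnorm v.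
Proof. by rewrite sqr_sqrtr ?sqnorm_ge0. Qed.

Lemma norm2Z n a (v : 'cV[R]_n) : norm2 (a *: v) = `|a| * norm2 v.
Proof. by rewrite /norm2 sqnormZ sqrtrM ?sqr_ge0 // sqrtr_sqr. Qed.

Lemma dotc_le n (u v : 'cV[R]_n) : dotc u v <= norm2 u * norm2 v.
Proof.
have [v0|v0] := eqVneq (sqnorm v) 0.
  by rewrite (sqnorm_eq0 v0) -(scale0r 0) dotcZr norm2Z mul0r normr0 mul0r mulr0.
have v_gt0 : 0 < sqnorm v by rewrite lt_def v0 sqnorm_ge0.
apply: (le_trans (ler_norm _)).
rewrite -(ger0_norm (mulr_ge0 (norm2_ge0 u) (norm2_ge0 v))) -ler_sqr ?nnegrE //.
rewrite !real_normK ?num_real // exprMn !sqr_norm2.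
(* Up to the factor [sqnorm v], this vector is the component of [u] orthogonal to [v]; its squared
   norm is [sqnorm v] times the Cauchy-Schwarz defect. *)
have := sqnorm_ge0 (sqnorm v *: u + (- dotc u v) *: v).
rewrite sqnormD !sqnormZ dotcZl dotcZr.
have -> : sqnorm v ^+ 2 * sqnorm u + 2 * (sqnorm v * (- dotc u v * dotc u v)) +
    (- dotc u v) ^+ 2 * sqnorm v
  = sqnorm v * (sqnorm u * sqnorm v - dotc u v ^+ 2) by ring.
by rewrite pmulr_rge0 // subr_ge0.
Qed.

Lemma ler_norm2 m n (u : 'cV[R]_m) (v : 'cV[R]_n) :
  (norm2 u <= norm2 v) = (sqnorm u <= sqnorm v).
Proof. by rewrite ler_sqrt // sqnorm_ge0. Qed.

Lemma norm2D n (u v : 'cV[R]_n) : norm2 (u + v) <= norm2 u + norm2 v.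
Proof.
rewrite -ler_sqr ?nnegrE ?addr_ge0 ?norm2_ge0 // sqr_norm2 sqnormD sqrrD !sqr_norm2.
by have := dotc_le u v; lra.
Qed.

End Euclidean.

(** * Singular values, trace duality and rank one perturbations of the nuclear norm *)

Section NuclearNorm.
Variables (R : realType) (m n : nat).
Implicit Types A Z : 'M[R]_(m, n).

Lemma dotc_col p (A B : 'M[R]_(p, n)) i j :
  dotc (col i A) (col j B) = (A^T *m B) i j.
Proof. by rewrite dotcE mxE; apply: eq_bigr => k _; rewrite !mxE. Qed.

Lemma mulmx_col p q (A : 'M[R]_(p, q)) (B : 'M[R]_(q, n)) i :
  A *m col i B = col i (A *m B).
Proof. by rewrite !colE mulmxA. Qed.

(** The columns of [V] are right singular vectors. This replaces the list picked by [xget] with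
    square roots of the eigenvalues of [A^T *m A]. *)
Lemma singular_decomposition A :
  exists V (s : 'I_n -> R),
  [/\ V^T *m V = 1%:M, forall i, 0 <= s i,
      V^T *m (A^T *m A) *m V = diag_mx (\row_i s i ^+ 2)
    & nucnorm A = \sum_i s i].
Proof.
have [|V [e [VV VAV]]] := @symmetric_spectral R n (A^T *m A).
  by rewrite trmx_mul trmxK.
have e_ge0 i : 0 <= e 0 i.
  have -> : e 0 i = sqnorm (A *m col i V).
    rewrite sqnormE mulmx_col dotc_col trmx_mul mulmxA -(mulmxA V^T) VAV.
    by rewrite !mxE eqxx.
  exact: sqnorm_ge0.
pose s i := Num.sqrt (e 0 i).
have s2 i : s i ^+ 2 = e 0 i by rewrite sqr_sqrtr.
have eE : e = \row_i s i ^+ 2 by apply/rowP => i; rewrite mxE s2.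
exists V, s; split=> // [i||]; [exact: sqrtr_ge0|by rewrite -eE|].
have charE : char_poly (A^T *m A) = \prod_(i < n) ('X - (s i ^+ 2)%:P).
  transitivity (char_poly (diag_mx e)).
    rewrite -VAV /char_poly /char_poly_mx.
    have VVX : map_mx polyC V^T *m map_mx polyC V = 1%:M by rewrite -map_mxM VV map_mx1.
    rewrite -[LHS]mul1r -(det1 _ n) -VVX det_mulmx mulrAC -!det_mulmx mulmxBr mulmxBl.
    by rewrite !map_mxM mul_mx_scalar -scalemxAl VVX scalemx1.
  rewrite char_poly_trig ?diag_mx_is_trig //.
  by apply: eq_bigr => i _; rewrite mxE eqxx s2.
have spec_s : singular_values_spec A [seq s i | i <- enum 'I_n].
  split; first by apply/allP => _ /mapP[i _ ->]; exact: sqrtr_ge0.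
  by rewrite charE big_map big_enum.
(* The chosen list [t] is a permutation of [s]: the characteristic polynomial fixes the squares up
   to order, and nonnegativity recovers the entries. *)
rewrite /nucnorm; case: xgetP => [t _ [t_ge0 t_char]|/(_ _ spec_s)//].
have : perm_eq [seq x ^+ 2 | x <- t] [seq x ^+ 2 | x <- [seq s i | i <- enum 'I_n]].
  apply: prod_XsubC_eq; rewrite [LHS]big_map 2![RHS]big_map -t_char charE.
  by rewrite big_enum.
have sqrtK (r : seq R) : all (fun x => 0 <= x) r ->
    map Num.sqrt (map (fun x => x ^+ 2) r) = r.
  move=> /allP r0; rewrite -map_comp -[RHS]map_id; apply/eq_in_map => x /r0 x0 /=.
  by rewrite sqrtr_sqr ger0_norm.
move=> /(perm_map Num.sqrt); rewrite !sqrtK //; last by case: spec_s.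
by move=> /(perm_big _) ->; rewrite big_map big_enum.
Qed.

Lemma nucnorm_ge0 A : 0 <= nucnorm A.
Proof.
by have [V [s [_ s0 _ ->]]] := singular_decomposition A; apply: sumr_ge0.
Qed.

(** Computed in the basis of right singular vectors [v_i], the trace is the sum of the products of
    [Z v_i] with [A v_i]; Cauchy-Schwarz bounds each by [h * s i]. *)
Lemma trace_le_nucnorm h A Z :
  (forall v, norm2 (Z *m v) <= h * norm2 v) -> \tr (Z^T *m A) <= h * nucnorm A.
Proof.
move=> Zh; have [V [s [VV s0 VAV ->]]] := singular_decomposition A.
have VV' : V *m V^T = 1%:M by exact: mulmx1C.
have colV i : norm2 (col i V) = 1.
  by rewrite /norm2 sqnormE dotc_col VV mxE eqxx sqrtr1.
have colAV i : norm2 (A *m col i V) = s i.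
  rewrite /norm2 sqnormE mulmx_col dotc_col trmx_mul mulmxA -(mulmxA V^T) VAV.
  by rewrite !mxE eqxx sqrtr_sqr ger0_norm.
have -> : \tr (Z^T *m A) = \sum_i dotc (Z *m col i V) (A *m col i V).
  rewrite -(mulmx1 (Z^T *m A)) -VV' mulmxA mxtrace_mulC mulmxA.
  by apply: eq_bigr => i _; rewrite !mulmx_col dotc_col trmx_mul !mulmxA.
rewrite mulr_sumr; apply: ler_sum => i _; apply: (le_trans (dotc_le _ _)).
by rewrite colAV ler_wpM2r // (le_trans (Zh _)) // colV mulr1.
Qed.

(** The certificate is the partial isometry of the polar decomposition of [A]. Since [0^-1 = 0], the
    matrix [D] inverts only the nonzero singular values, so [Z] vanishes on the kernel of [A]. *)
Lemma nucnorm_dual A :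
  exists Z, [/\ \tr (Z^T *m A) = nucnorm A,
    forall v, norm2 (Z *m v) <= norm2 v & forall u : 'cV_n, A *m u = 0 -> Z *m u = 0].
Proof.
have [V [s [VV s0 VAV nucA]]] := singular_decomposition A.
have VV' : V *m V^T = 1%:M by exact: mulmx1C.
pose D := diag_mx (\row_i (s i)^-1).
have DT : D^T = D by rewrite tr_diag_mx.
exists (A *m V *m D *m V^T); split.
- rewrite !trmx_mul trmxK DT -!mulmxA mxtrace_mulC -(mulmxA D) VAV.
  rewrite mulmx_diag mxtrace_diag nucA; apply: eq_bigr => i _; rewrite !mxE.
  by have [->|si] := eqVneq (s i) 0; [rewrite expr0n mulr0|field].
- move=> v; rewrite ler_norm2 -!mulmxA; set u := V^T *m v.
  have -> : sqnorm v = sqnorm u.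
    by rewrite !sqnormE dotc_mull trmxK mulmxA VV' mul1mx.
  have VAVu (x : 'cV_n) :
      V^T *m (A^T *m (A *m (V *m x))) = diag_mx (\row_i s i ^+ 2) *m x.
    by rewrite -VAV !mulmxA.
  clearbody u; rewrite sqnormE !dotc_mull DT VAVu !mulmxA /D !mulmx_diag.
  rewrite sqnormE !dotcE; apply: ler_sum => i _.
  rewrite mul_diag_mx !mxE mulrCA -expr2 -[leRHS]mul1r ler_wpM2r ?sqr_ge0 //.
  have [->|si] := eqVneq (s i) 0; first by rewrite invr0 !mul0r.
  by rewrite le_eqVlt; apply/orP; left; apply/eqP; field.
- move=> u Au; rewrite -!mulmxA.
  suff -> : D *m (V^T *m u) = 0 by rewrite !mulmx0.
  have : diag_mx (\row_i s i ^+ 2) *m (V^T *m u) = 0.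
    by rewrite -VAV -!mulmxA (mulmxA V) VV' mul1mx Au !mulmx0.
  rewrite /D !mul_diag_mx => /colP su; apply/colP => i.
  move: (su i); rewrite !mxE => /eqP; rewrite mulf_eq0 expf_eq0 /=.
  by case/orP => /eqP ->; rewrite ?invr0 ?mul0r ?mulr0.
Qed.

Lemma sqnorm_trmx (u : 'cV[R]_n) : u^T *m u = (sqnorm u)%:M.
Proof. by rewrite [LHS]mx11_scalar sqnormE. Qed.

Lemma trace_mul_rank1 A (u : 'cV_n) (c : 'cV_m) :
  \tr (A^T *m (c *m u^T)) = dotc (A *m u) c.
Proof. by rewrite mulmxA mxtrace_mulC /dotc trmx_mul mulmxA trace_mx11. Qed.

(* The optimal certificate [Z] of [A] kills [u], so [Z] and [c *m u^T] act on
   orthogonal directions; with [N = nucnorm A] the combination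
   [N *: Z + c *m u^T] certifies the bound. *)
Lemma nucnorm_rank1 A (u : 'cV_n) (c : 'cV_m) : A *m u = 0 ->
  nucnorm A ^+ 2 + sqnorm c * sqnorm u <= nucnorm (A + c *m u^T) ^+ 2.
Proof.
move=> Au; have [Z [trZ Z1 Zker]] := nucnorm_dual A.
set N := nucnorm A in trZ *; set M := A + _.
have N0 : 0 <= N := nucnorm_ge0 A.
have [u0|u0] := eqVneq u 0.
  by rewrite /M u0 trmx0 mulmx0 addr0 -(scale0r 0) sqnormZ expr0n mul0r mulr0 addr0.
have U0 : 0 < sqnorm u.
  by rewrite lt_def sqnorm_ge0 andbT; apply: contra_neq u0 => /sqnorm_eq0.
(* [h] bounds the operator norm of [N *: Z + c *m u^T], whose trace pairing with [M] is [h ^+ 2];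
   duality then gives [h <= nucnorm M]. *)
pose h := Num.sqrt (N ^+ 2 + sqnorm c * sqnorm u).
have h2 : h ^+ 2 = N ^+ 2 + sqnorm c * sqnorm u.
  by rewrite sqr_sqrtr // addr_ge0 ?sqr_ge0 // mulr_ge0 ?sqnorm_ge0.
have h0 : 0 <= h := sqrtr_ge0 _.
have : h ^+ 2 <= h * nucnorm M.
  have -> : h ^+ 2 = \tr ((N *: Z + c *m u^T)^T *m M).
    have -> : (N *: Z + c *m u^T)^T = N *: Z^T + (c *m u^T)^T.
      by apply/matrixP => k l; rewrite !mxE.
    have cA : \tr ((c *m u^T)^T *m A) = 0.
      rewrite -mxtrace_tr trmx_mul trmxK trace_mul_rank1 Au.
      by rewrite -(scale0r 0) dotcZl mul0r.
    have cc : \tr ((c *m u^T)^T *m (c *m u^T)) = sqnorm c * sqnorm u.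
      rewrite trace_mul_rank1 -mulmxA sqnorm_trmx mul_mx_scalar.
      by rewrite dotcZl -sqnormE mulrC.
    have Zc : \tr (Z^T *m (c *m u^T)) = 0.
      by rewrite trace_mul_rank1 (Zker u) // -(scale0r 0) dotcZl mul0r.
    rewrite /M mulmxDl !mulmxDr -!scalemxAl !mxtraceD !mxtraceZ trZ cA cc Zc h2.
    by ring.
  apply: trace_le_nucnorm => v.
  rewrite -ler_sqr ?nnegrE ?mulr_ge0 ?norm2_ge0 // exprMn !sqr_norm2 h2.
  (* Split [v] into [v'] orthogonal to [u] plus [t *: u]: [Z] sees only [v'], and [c *m u^T] only
     [t *: u]. *)
  pose t := dotc u v / sqnorm u.
  have [v' vE] : exists v', v = v' + t *: u by exists (v - t *: u); rewrite subrK.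
  have v'u : dotc v' u = 0.
    have : dotc v u = t * sqnorm u by rewrite dotcC /t divfK // gt_eqF.
    by rewrite vE dotcDl dotcZl -sqnormE; lra.
  have Zv : (N *: Z + c *m u^T) *m v = N *: (Z *m v') + (t * sqnorm u) *: c.
    have Zvv' : Z *m v = Z *m v'.
      by rewrite vE (mulmxDr Z v') -(scalemxAr t Z u) (Zker u) // scaler0 addr0.
    rewrite mulmxDl -scalemxAl Zvv'.
    congr (_ + _); rewrite -mulmxA [u^T *m v]mx11_scalar -/(dotc u v).
    by rewrite mul_mx_scalar; congr (_ *: _); rewrite /t divfK // gt_eqF.
  rewrite Zv -sqr_norm2.
  have sqv : sqnorm v = sqnorm v' + t ^+ 2 * sqnorm u.
    by rewrite vE sqnormD dotcZr v'u !mulr0 addr0 sqnormZ.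
  have -> : sqnorm v = norm2 v' ^+ 2 + t ^+ 2 * sqnorm u by rewrite sqr_norm2.
  have := norm2D (N *: (Z *m v')) ((t * sqnorm u) *: c).
  rewrite !norm2Z (ger0_norm N0) normrM (ger0_norm (ltW U0)) => le1.
  have le2 : N * norm2 (Z *m v') <= N * norm2 v' by rewrite ler_wpM2l.
  have le3 : norm2 (N *: (Z *m v') + (t * sqnorm u) *: c) <=
      N * norm2 v' + `|t| * sqnorm u * norm2 c by lra.
  apply: (@le_trans _ _ ((N * norm2 v' + `|t| * sqnorm u * norm2 c) ^+ 2)).
    by rewrite ler_sqr ?nnegrE ?norm2_ge0 // (le_trans (norm2_ge0 _) le3).
  rewrite -(real_normK (num_real t)) -(sqr_norm2 c) -subr_ge0.
  set a := norm2 v'; set b := norm2 c; set U := sqnorm u in U0 *; set T := `|t|.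
  (* Lagrange's identity for the plane vectors [(N, b sqrt U)] and [(a, T sqrt U)]. *)
  have -> : (N ^+ 2 + b ^+ 2 * U) * (a ^+ 2 + T ^+ 2 * U) - (N * a + T * U * b) ^+ 2
    = U * (N * T - b * a) ^+ 2 by ring.
  by rewrite mulr_ge0 ?sqr_ge0 // ltW.
rewrite -h2 expr2; have [->|h_neq0] := eqVneq h 0.
  by rewrite mul0r sqr_ge0.
rewrite ler_pM2l ?lt_def ?h_neq0 // => hM.
by rewrite -expr2 ler_sqr ?nnegrE ?nucnorm_ge0.
Qed.

(** The certificate of [A], tested on the perturbed matrix, loses at most the product of [Z *m u]
    with [c]. *)
Lemma nucnorm_perturb A (u : 'cV_n) (c : 'cV_m) :
  nucnorm A <= nucnorm (A + c *m u^T) + norm2 c * norm2 u.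
Proof.
have [Z [trZ Z1 _]] := nucnorm_dual A.
have : \tr (Z^T *m (A + c *m u^T)) <= 1 * nucnorm (A + c *m u^T).
  by apply: trace_le_nucnorm => v; rewrite mul1r.
rewrite mulmxDr mxtraceD trZ trace_mul_rank1 mul1r => le1.
have := dotc_le (- (Z *m u)) c; rewrite -scaleN1r dotcZl norm2Z normrN1 mul1r mulN1r.
have := ler_wpM2r (norm2_ge0 c) (Z1 u); rewrite (mulrC (norm2 u)).
lra.
Qed.

End NuclearNorm.

(** * Averaging two coefficients and the resulting quantitative bound *)

Section Grouping.
Variables (R : realType) (d n : nat).
Implicit Types (A X : 'M[R]_(d, n)) (w v : 'cV[R]_n) (x y c : 'cV[R]_d).

Lemma mulmx_trmxE c w r l : (c *m w^T) r l = c r 0 * w l 0.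
Proof. by rewrite mxE big_ord1 mxE. Qed.

Lemma sqnorm_delta (l : 'I_n) : sqnorm (delta_mx l 0 : 'cV[R]_n) = 1.
Proof.
rewrite /sqnorm (bigD1 l) //= big1 ?addr0 ?mxE ?eqxx ?expr1n // => k kl.
by rewrite mxE (negPf kl) expr0n.
Qed.

Lemma norm2_delta (l : 'I_n) : norm2 (delta_mx l 0 : 'cV[R]_n) = 1.
Proof. by rewrite /norm2 sqnorm_delta sqrtr1. Qed.

(** With column [l] removed, [A] kills the basis vector [e_l]; restoring the column is a rank one
    change covered by [nucnorm_rank1]. *)
Lemma norm2_col_le_nucnorm A l : norm2 (col l A) <= nucnorm A.
Proof.
have A0 : (A - col l A *m (delta_mx l 0)^T) *m (delta_mx l 0 : 'cV_n) = 0.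
  by rewrite mulmxBl -mulmxA sqnorm_trmx sqnorm_delta mulmx1 -colE subrr.
have := nucnorm_rank1 (col l A) A0; rewrite subrK sqnorm_delta mulr1 => le1.
rewrite -ler_sqr ?nnegrE ?norm2_ge0 ?nucnorm_ge0 // sqr_norm2 (le_trans _ le1) //.
by rewrite lerDr sqr_ge0.
Qed.

Lemma nucnorm0 : nucnorm (0 : 'M[R]_(d, n)) = 0.
Proof.
have [Z [<- _ _]] := nucnorm_dual (0 : 'M[R]_(d, n)).
by rewrite mulmx0 mxtrace0.
Qed.

Lemma col_mul_diag X w l : col l (X *m diag_mx w^T) = w l 0 *: col l X.
Proof. by apply/colP => r; rewrite mul_mx_diag !mxE mulrC. Qed.

(** [NA] and [NA'] stand for the nuclear norms for [X] at [w] and at the averaged [w']; [NT'] and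
    [NT], in this order, for those with [x_i] replaced by [x_j]. [S], [t], [q] expand the squared
    residual at [w']. *)
Lemma combine_estimates (L NA NA' NT NT' a b S t q D : R) : 0 <= L ->
  NT' <= NA + a -> NA' <= NT + b ->
  2^-1 * S + L * NA <= 2^-1 * (S + 2 * t + q) + L * NA' -> t <= D ->
  L * NT' <= L * (NT + (a + b)) + D + q / 2.
Proof.
move=> L0 /(ler_wpM2l L0) le1 /(ler_wpM2l L0) le2 le3 le4; lra.
Qed.

(* [N] and [N'] are the nuclear norms after replacing [x_i] by [x_j], with and
   without averaging [w_i] and [w_j]. *)
Lemma averaging_bound y (lam : R) X w (i j : 'I_n) :
  i != j -> 0 < lam ->
  (forall v, trace_lasso_obj y lam X w <= trace_lasso_obj y lam X v) ->
  let x := col j X in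
  let e := norm2 (col i X - x) in
  let delta := (w i 0 - w j 0) / 2 in
  let m := (w i 0 + w j 0) / 2 in
  exists2 N, 0 <= N &
  exists N', [/\ N ^+ 2 + 2 * delta ^+ 2 * sqnorm x <= N' ^+ 2, 0 <= N',
    N' <= nucnorm (X *m diag_mx w^T) + `|w i 0| * e &
    lam * N' <= lam * (N + (`|w i 0| + `|m|) * e)
       + `|delta| * norm2 (y - X *m w) * e + delta ^+ 2 * e ^+ 2 / 2].
Proof.
move=> ij lam0 opt x e delta m.
pose f : 'cV[R]_n := delta_mx i 0 - delta_mx j 0.
pose w' := w - delta *: f.
pose E := col i X - x.
(* Both entries [i] and [j] of [w'] equal [m], and the correction turns column [i] from [m x_i] into
   [m x]. Columns [i] and [j] of [T'] then agree, so [T'] kills [f]. *)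
pose T' := X *m diag_mx w'^T + (- m *: E) *m (delta_mx i 0)^T.
have fE k : f k 0 = (k == i)%:R - (k == j)%:R by rewrite !mxE !andbT.
have sqf : sqnorm f = 2.
  rewrite sqnormD sqnorm_delta -scaleN1r sqnormZ sqnorm_delta dotcZr.
  have -> : dotc (delta_mx i 0) (delta_mx j 0 : 'cV[R]_n) = 0.
    by rewrite /dotc trmx_delta mul_delta_mx_0 // mxE.
  by ring.
have EE r : E r 0 = X r i - X r j by rewrite !mxE.
have w'E l : w' l 0 = w l 0 - delta * f l 0 by rewrite !mxE.
have T'E r l : T' r l = X r l * w' l 0 - m * E r 0 * (l == i)%:R.
  by rewrite /T' mxE mulmx_trmxE mul_mx_diag !mxE eqxx andbT mulNr mulNr.
have T'f : T' *m f = 0.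
  rewrite mulmxBr -!colE; apply/colP => r.
  have -> (M : 'M[R]_(d, n)) : (col i M - col j M) r 0 = M r i - M r j by rewrite !mxE.
  rewrite !T'E EE !w'E !fE !eqxx (negPf ij) eq_sym (negPf ij) mxE /delta /m /=.
  by field.
(* The first two terms give columns [w_i x] and [w_j x], the unaveraged matrix with [x_i] replaced
   by [x]; the last term restores [x_i]. *)
have TE : X *m diag_mx w^T =
    T' + (delta *: x) *m f^T + (w i 0 *: E) *m (delta_mx i 0)^T.
  apply/matrixP => r l.
  have -> : (T' + (delta *: x) *m f^T + (w i 0 *: E) *m (delta_mx i 0)^T) r l =
      T' r l + delta * X r j * f l 0 + w i 0 * E r 0 * (l == i)%:R.
    by rewrite 2!mxE !mulmx_trmxE [(_ *: x) r 0]mxE [(_ *: E) r 0]mxE !mxE eqxx andbT.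
  rewrite T'E EE w'E fE mul_mx_diag !mxE /delta /m.
  have [->|li] := eqVneq l i; first by rewrite (negPf ij) /=; field.
  by have [->|lj] := eqVneq l j; rewrite /=; field.
have Xw' : y - X *m w' = (y - X *m w) + delta *: E.
  by rewrite /w' mulmxBr -scalemxAr mulmxBr -!colE opprB -/x -/E addrA addrAC.
exists (nucnorm T'); first by exact: nucnorm_ge0.
exists (nucnorm (T' + (delta *: x) *m f^T)).
have le1 := nucnorm_rank1 (delta *: x) T'f.
have := nucnorm_perturb (T' + (delta *: x) *m f^T) (delta_mx i 0) (w i 0 *: E).
rewrite -TE norm2Z norm2_delta mulr1 -/e => le2.
have := nucnorm_perturb (X *m diag_mx w'^T) (delta_mx i 0) (- m *: E).
rewrite -/T' norm2Z norm2_delta mulr1 normrN -/e => le3.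
have := opt w'; rewrite /trace_lasso_obj Xw' (sqnormD (y - X *m w)) dotcZr sqnormZ.
rewrite -(sqr_norm2 E) -/e => le4.
have le5 : delta * dotc (y - X *m w) E <= `|delta| * norm2 (y - X *m w) * e.
  rewrite -dotcZr (le_trans (dotc_le _ _)) // norm2Z.
  by rewrite mulrCA mulrA.
split.
- have -> // : 2 * delta ^+ 2 * sqnorm x = sqnorm (delta *: x) * sqnorm f.
  by rewrite sqnormZ sqf; ring.
- exact: nucnorm_ge0.
- exact: le2.
- rewrite (mulrDl `|w i 0|).
  exact: (combine_estimates (ltW lam0) le2 le3 le4 le5).
Qed.

(** Compare with the zero vector, where the objective is [sqnorm y / 2]. *)
Lemma objective_at_optimum y (lam : R) X w :
  0 < lam ->
  (forall v, trace_lasso_obj y lam X w <= trace_lasso_obj y lam X v) ->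
  norm2 (y - X *m w) <= norm2 y /\ nucnorm (X *m diag_mx w^T) <= sqnorm y / (2 * lam).
Proof.
move=> lam0 /(_ 0); rewrite /trace_lasso_obj mulmx0 subr0 trmx0.
have -> : diag_mx (0 : 'rV[R]_n) = 0 by apply/matrixP => k l; rewrite !mxE mul0rn.
rewrite mulmx0 nucnorm0 mulr0 addr0 => le1.
have := mulr_ge0 (ltW lam0) (nucnorm_ge0 (X *m diag_mx w^T)).
have := sqnorm_ge0 (y - X *m w) => ge1 ge2; split.
  by rewrite ler_norm2; lra.
rewrite ler_pdivlMr ?mulr_gt0 //; lra.
Qed.

(** [K] is chosen before [X] and [w], so one constant serves a whole sequence of data matrices
    sharing the column [x]. *)
Lemma grouping_bound y (lam : R) x (i j : 'I_n) :
  i != j -> 0 < lam -> x != 0 ->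
  exists K, forall X w, col j X = x ->
  (forall v, trace_lasso_obj y lam X w <= trace_lasso_obj y lam X v) ->
  norm2 (col i X - x) <= 1 -> norm2 (col i X - x) <= norm2 x / 2 ->
  (w i 0 - w j 0) ^+ 2 <= K * norm2 (col i X - x).
Proof.
move=> ij lam0 x0.
have x_gt0 : 0 < norm2 x.
  rewrite lt_def norm2_ge0 andbT; apply: contra_neq x0 => nx0.
  by apply: sqnorm_eq0; rewrite -sqr_norm2 nx0 expr0n.
(* [B] bounds the nuclear norm at the optimum, [K1] the coefficients [w_i] and [w_j], [K2 * e] the
   gap [N' - N], and [K3 * e] the gap between their squares. *)
pose B := sqnorm y / (2 * lam).
pose K1 := 2 * B / norm2 x.
pose K2 := 2 * K1 + (K1 * norm2 y + K1 ^+ 2 / 2) / lam.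
pose K3 := 2 * (B + K1) * K2 + K2 ^+ 2.
exists (2 * K3 / sqnorm x) => X w colj opt e1 ex.
have [res nucB] := objective_at_optimum lam0 opt.
have [N N0 [N' []]] := averaging_bound ij lam0 opt.
rewrite colj.
set e := norm2 _ in e1 ex *; set delta := _ / 2; set m := (_ + _) / 2.
have e0 : 0 <= e := norm2_ge0 _.
move=> le1 N'0 le2 le3.
have wl l : norm2 x / 2 <= norm2 (col l X) -> `|w l 0| <= K1.
  move=> xl; rewrite /K1 ler_pdivlMr //.
  have := norm2_col_le_nucnorm (X *m diag_mx w^T) l.
  rewrite col_mul_diag norm2Z => le4.
  have := ler_wpM2l (normr_ge0 (w l 0)) xl; rewrite -/B in nucB; lra.
(* As [e <= norm2 x / 2], the triangle inequality keeps the norm of [x_i] at least [norm2 x / 2]. *)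
have wi : `|w i 0| <= K1.
  apply: wl; have := norm2D (x - col i X) (col i X); rewrite subrK.
  have -> : norm2 (x - col i X) = e by rewrite -opprB -scaleN1r norm2Z normrN1 mul1r.
  lra.
have wj : `|w j 0| <= K1 by apply: wl; rewrite colj; lra.
have dK : `|delta| <= K1.
  move: wi wj; rewrite /delta !ler_norml => /andP[? ?] /andP[? ?].
  by apply/andP; split; lra.
have mK : `|m| <= K1.
  move: wi wj; rewrite /m !ler_norml => /andP[? ?] /andP[? ?].
  by apply/andP; split; lra.
have K10 : 0 <= K1 := le_trans (normr_ge0 _) wi.
have K20 : 0 <= K2.
  have cr : 0 <= K1 * norm2 y + K1 ^+ 2 / 2.
    by apply: addr_ge0; rewrite mulr_ge0 ?norm2_ge0 ?sqr_ge0 ?invr_ge0.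
  by apply: addr_ge0; rewrite mulr_ge0 // invr_ge0 ltW.
have N'B : N' <= B + K1.
  have : `|w i 0| * e <= K1 * 1 by apply: ler_pM.
  rewrite -/B in nucB; lra.
have NN' : N <= N'.
  rewrite -ler_sqr ?nnegrE // (le_trans _ le1) // lerDl mulr_ge0 ?sqnorm_ge0 //.
  by rewrite mulr_ge0 ?sqr_ge0.
have N'K : N' <= N + K2 * e.
  have -> : K2 = 2 * K1 + (K1 * norm2 y + K1 ^+ 2 / 2) / lam by [].
  rewrite -(ler_pM2l lam0) (le_trans le3) //.
  have -> : lam * (N + (2 * K1 + (K1 * norm2 y + K1 ^+ 2 / 2) / lam) * e) =
    lam * (N + (K1 + K1) * e) + K1 * norm2 y * e + K1 ^+ 2 * e / 2.
    by field; rewrite gt_eqF.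
  have h1 : (`|w i 0| + `|m|) * e <= (K1 + K1) * e by rewrite ler_wpM2r // lerD.
  have h2 : `|delta| * norm2 (y - X *m w) * e <= K1 * norm2 y * e.
    by rewrite ler_wpM2r // ler_pM // norm2_ge0.
  have h3 : delta ^+ 2 * e ^+ 2 <= K1 ^+ 2 * e.
    rewrite -(real_normK (num_real delta)) ler_pM ?sqr_ge0 //.
      by rewrite ler_sqr ?nnegrE.
    by rewrite expr2 -[leRHS]mulr1 ler_wpM2l.
  have := ler_wpM2l (ltW lam0) h1; lra.
have : N' ^+ 2 <= (N + K2 * e) ^+ 2.
  by rewrite ler_sqr ?nnegrE // addr_ge0 // mulr_ge0.
(* Uses [N <= N' <= B + K1] and, since [e <= 1], [e ^+ 2 <= e]. *)
have h4 : (N + K2 * e) ^+ 2 <= N ^+ 2 + K3 * e.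
  have a1 : N * (K2 * e) <= (B + K1) * (K2 * e).
    by rewrite ler_wpM2r ?mulr_ge0 // (le_trans NN').
  have a2 : K2 ^+ 2 * e ^+ 2 <= K2 ^+ 2 * e.
    by rewrite ler_wpM2l ?sqr_ge0 // expr2 -[leRHS]mulr1 ler_wpM2l.
  rewrite /K3; lra.
move=> h5.
rewrite mulrAC ler_pdivlMr -?sqr_norm2 ?exprn_gt0 // sqr_norm2.
have -> : (w i 0 - w j 0) ^+ 2 * sqnorm x = 2 * (2 * delta ^+ 2 * sqnorm x).
  by rewrite /delta; field.
lra.
Qed.

End Grouping.

(** * Passage to the limit *)

Theorem theorem3 (R : realType) (d n : nat) (y : 'cV[R]_d) (lam : R)
    (i j : 'I_n) (X0 : 'M[R]_(d, n))
    (Xs : nat -> 'M[R]_(d, n)) (ws : nat -> 'cV[R]_n) :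
  0 < lam ->
  (* the other columns of X are fixed *)
  (forall k (l : 'I_n) (r : 'I_d), l != i -> Xs k r l = X0 r l) ->
  (* x_i -> x_j *)
  (forall r : 'I_d, (fun k => Xs k r i) @ \oo --> (X0 r j : R)) ->
  (* ws k is the optimal solution for the data matrix Xs k *)
  (forall k, is_unique_minimizer y lam (Xs k) (ws k)) ->
  (fun k => ws k i 0 - ws k j 0) @ \oo --> (0 : R).
Proof.
move=> lam0 fixed Xi opt.
have [<-|ij] := eqVneq i j.
  by under eq_cvg do rewrite subrr; exact: cvg_cst.
pose x := col j X0.
have colj k : col j (Xs k) = x by apply/colP => r; rewrite !mxE fixed // eq_sym.
(* If [x_j] were zero, adding [e_j] to the minimizer would leave the objective unchanged, against
   uniqueness. *)
have x0 : x != 0.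
  apply/eqP => x0; have [min uniq] := opt 0%N.
  pose v := ws 0%N + delta_mx j 0.
  have /uniq /colP/(_ j) : forall u,
      trace_lasso_obj y lam (Xs 0%N) v <= trace_lasso_obj y lam (Xs 0%N) u.
    suff -> : trace_lasso_obj y lam (Xs 0%N) v =
      trace_lasso_obj y lam (Xs 0%N) (ws 0%N) by [].
    rewrite /trace_lasso_obj mulmxDr -colE colj x0 addr0; congr (_ + _ * nucnorm _).
    apply/matrixP => r l; rewrite !mul_mx_diag !mxE eqxx andbT.
    have [->|_] := eqVneq l j; last by rewrite addr0.
    by have /colP/(_ r) := colj 0%N; rewrite x0 !mxE => ->; rewrite !mul0r.
  by rewrite !mxE !eqxx /= => /eqP; rewrite -subr_eq0 addrAC subrr add0r oner_eq0.
have [K Kbound] := grouping_bound y ij lam0 x0.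
have sqrt_cvg0 (u : nat -> R) :
    u @ \oo --> (0 : R) -> (Num.sqrt \o u) @ \oo --> (0 : R).
  move=> u0; rewrite -[X in _ --> X]sqrtr0.
  by apply: cvg_comp u0 _; exact: sqrt_continuous.
have e_cvg : (fun k => norm2 (col i (Xs k) - x)) @ \oo --> (0 : R).
  apply: (sqrt_cvg0 (fun k => sqnorm (col i (Xs k) - x))).
  have -> : 0 = \sum_(r < d) (X0 r j - X0 r j) ^+ 2 :> R.
    by rewrite big1 // => r _; rewrite subrr expr0n.
  apply: (@cvg_big R); [exact: add_continuous|move=> r _].
  under eq_fun do rewrite !mxE expr2.
  by rewrite expr2; apply: cvgM; apply: cvgB (Xi r) (cvg_cst _).
have Ke_cvg : (fun k => K * norm2 (col i (Xs k) - x)) @ \oo --> (0 : R).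
  by rewrite -[X in _ --> X](mulr0 K); apply: cvgM e_cvg; exact: cvg_cst.
have x_gt0 : 0 < norm2 x.
  by rewrite sqrtr_gt0 lt_def sqnorm_ge0 andbT; apply: contra_neq x0 => /sqnorm_eq0.
have e_le z : 0 < z -> \forall k \near \oo, norm2 (col i (Xs k) - x) <= z.
  by move=> z0; exact: cvgr_le e_cvg z z0.
(* Squeeze between 0 and [K] times the distance from [x_i] to [x]; the two smallness conditions of
   the bound hold eventually. *)
have sq_cvg : (fun k => (ws k i 0 - ws k j 0) ^+ 2) @ \oo --> (0 : R).
  apply: (squeeze_cvgr _ (cvg_cst (0 : R)) Ke_cvg).
  near=> k; rewrite sqr_ge0; apply: (Kbound _ _ (colj k)).
  - by case: (opt k).
  - by near: k; exact: e_le.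
  - by near: k; apply: e_le; rewrite divr_gt0.
apply/norm_cvg0P; under eq_fun do rewrite -sqrtr_sqr.
exact: sqrt_cvg0 sq_cvg.
Unshelve. all: by end_near.
Qed.
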